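(* Let $G$ be a graph with $n$ vertices and $e$ edges. Then $f(G)\ge a_{g(e)}$. Moreover, if $0\le e\le\lfloor\frac{n^2}{4}\rfloor+\lfloor\frac{n-1}{2}\rfloor-1$, then this bound is attained by some graph with $n$ vertices and $e$ edges, and in this case the extremal graphs (those graphs with $n$ vertices and $e$ edges satisfying $f(G)=a_{g(e)}$) are precisely the graphs with $n$ vertices and $e$ edges that are obtained from a complete bipartite graph on $n$ vertices by deleting $g(e)$ edges forming a star or by adding $g(e)$ edges forming a star.
   Context: All graphs are finite and simple. A triple of distinct vertices of a graph is a frustrated triangle if it induces an odd number of edges, and $f(G)$ denotes the number of frustrated triangles (unordered triples) in $G$. For fixed $n$ and integers $t\ge0$, $a_t=t(n-t-1)$ (for $t\le n-1$ this is the number of frustrated triangles in the $n$-vertex graph whose edges are $t$ edges forming a star). For integers $0\le x\le \frac n2$, let $c_x=x(n-x)$ be the number of edges of $K_{x,n-x}$, and for an integer $e$ let $g(e)=\min\{|e-c_x|: x\in\mathbb{Z},\ 0\le x\le\frac n2\}$. A complete bipartite graph may have an empty part, so the edgeless graph $K_{0,n}$ counts as complete bipartite. A set of edges forms a star if all of them share a common vertex (the empty set of edges is allowed when $g(e)=0$); added edges are previously nonadjacent pairs. *)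

(* Defs.v *)
From mathcomp Require Import all_boot all_order all_algebra.
Set Implicit Arguments.
Unset Strict Implicit.
Unset Printing Implicit Defensive.
Import Order.TTheory GRing.Theory Num.Theory.

Definition pairs (T : finType) : {set {set T}} := [set p : {set T} | #|p| == 2].

Record sgraph (T : finType) := SGraph {
  edges : {set {set T}};
  edges_pairs : edges \subset pairs T
}.

Definition frustrated (T : finType) (G : sgraph T) (t : {set T}) : bool :=
  (#|t| == 3) && odd #|[set p in edges G | p \subset t]|.

Definition nfrustrated (T : finType) (G : sgraph T) : nat :=
  #|[set t : {set T} | frustrated G t]|.

(* One of the two parts A and ~: A may be empty. *)
Definition complete_bipartite (T : finType) (H : sgraph T) : Prop :=
  exists A : {set T}, edges H = [set [set x; y] | x in A, y in ~: A].

(* The first disjunct only matters when T is empty. *)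
Definition is_star (T : finType) (S : {set {set T}}) : Prop :=
  S = set0 \/ exists v : T, forall p, p \in S -> v \in p.

Definition delete_star (T : finType) (k : nat) (H G : sgraph T) : Prop :=
  exists S : {set {set T}},
    [/\ S \subset edges H, is_star S, #|S| = k & edges G = edges H :\: S].

Definition add_star (T : finType) (k : nat) (H G : sgraph T) : Prop :=
  exists S : {set {set T}},
    [/\ S \subset pairs T :\: edges H, is_star S, #|S| = k
      & edges G = edges H :|: S].

Local Open Scope ring_scope.

(* Integer-valued: it is negative when t > n - 1 and t > 0. *)
Definition a_star (n t : nat) : int := t%:Z * (n%:Z - t%:Z - 1).

Definition c_bip (n x : nat) : int := x%:Z * (n%:Z - x%:Z).

(* The default value is the term x = 0 of the minimum, so it does not
   affect the result. *)
Definition g_dist (n : nat) (e : int) : nat :=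
  \big[minn/`|e - c_bip n 0|%N]_(x < n.+1 | (x.*2 <= n)%N) `|e - c_bip n x|%N.

(* Main.v *)
Require Import Defs.
From mathcomp Require Import all_boot all_order all_algebra zify.
Set Implicit Arguments.
Unset Strict Implicit.
Unset Printing Implicit Defensive.
Import Order.TTheory GRing.Theory Num.Theory.

(** Toggling all the pairs across a cut (A, ~: A) changes an even number of
    pairs in every triple, so it preserves the set of frustrated triangles
    (nfrust_switch).  Hence G may be replaced by a graph F with the fewest
    edges, say t, in its switching class.  Then G is the symmetric difference
    of F and a complete bipartite graph, so that g(e) <= t, and three
    estimates on f(F) give the theorem.  Let n be the number of vertices.

    - Small t.  Deleting an edge uv changes f by n - 2 - 2 D, where D is the
      number of vertices joined to exactly one of u and v
      (nfrust_del_edge).  These vertices give D distinct other edges, so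
      D <= t - 1 and induction on t yields f >= t (n - t - 1) = a_t for every
      graph with t edges (nfrust_ge).  If some edge has D < t - 1 then
      f >= a_t + 2; if D = t - 1 for all edges then the edges pairwise
      intersect and contain no triangle, i.e. they form a star
      (nfrust_small_star).  Conversely stars reach a_t (nfrust_star).

    - Large t.  For a vertex v, switching at the neighbourhood of v isolates
      v, and the frustrated triangles through v correspond to the edges of
      the switched graph (card_frust_at), of which there are at least t.
      Summing over v gives n t <= 3 f (switch_minimal_nfrust), which exceeds
      every a_g as soon as 4 t >= 3 n.

    - In between, n <= 2 t and 4 t < 3 n.  By minimality every degree is at
      most (n - 1) / 2, and as long as 2 t >= n + 2 some edge satisfies
      2 D <= n - 2 (exists_removable).  Deleting it does not increase f.
      Going on until t is n / 2 rounded up leads to a graph which by its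
      degrees is not a star, so 4 f > (n - 1)^2 (nfrust_gt_middle).

    As 4 a_g <= (n - 1)^2 always, and a_g <= a_t for g <= t < n / 2, the
    lower bound follows.  In case of equality t = g and F is a star; and
    since | e - c_x | >= g = t, the t edges of F must all be added to, or all
    deleted from, the complete bipartite graph.  Finally, when e is in the
    given range, 2 g(e) < n (g_dist_lt_half), which leaves enough room for a
    star of g(e) edges inside the larger part or across the cut. *)

(** * Edge sets, cuts and frustrated triples *)

Section EdgeSets.
Variable T : finType.
Implicit Types (E F S : {set {set T}}) (A B t : {set T}) (u v w x y z : T).

Definition symdiff E F : {set {set T}} := [set p | (p \in E) (+) (p \in F)].

(** The edge set of the complete bipartite graph with parts A and ~: A. *)
Definition cut A : {set {set T}} := [set [set x; y] | x in A, y in ~: A].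

(** frustrated and nfrustrated for a bare edge set E, which is convenient
    since E is constantly modified. *)
Definition frust E t : bool := (#|t| == 3) && odd #|[set p in E | p \subset t]|.

Definition nfrust E : nat := #|[set t | frust E t]|.

(** The vertices outside {u, v} that are adjacent to exactly one of u and v. *)
Definition splitters E u v : {set T} :=
  [set w | (w \notin [set u; v])
             && (([set u; w] \in E) (+) ([set v; w] \in E))].

Lemma pairsP (p : {set T}) :
  reflect (exists x y, x != y /\ p = [set x; y]) (p \in pairs T).
Proof. by rewrite inE; apply: cards2P. Qed.

Lemma mem_pairs2 x y : ([set x; y] \in pairs T) = (x != y).
Proof. by rewrite inE cards2; case: (x != y). Qed.

Lemma set2_eqr x y z : ([set x; y] == [set x; z]) = (y == z).
Proof.
apply/eqP/eqP=> [/setP e|-> //]; have := e y; have := e z.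
rewrite !inE !eqxx !orbT => /orP[/eqP zx|/eqP-> //].
by rewrite zx orbb => /esym/eqP.
Qed.

Lemma mem_cut A x y : ([set x; y] \in cut A) = (x \in A) (+) (y \in A).
Proof.
apply/imset2P/idP => [[a b aA]|].
  rewrite inE => bA /setP e.
  have := e a; have := e b; have := e x; have := e y.
  rewrite !inE !eqxx !orbT /= => /esym /orP[]/eqP-> /esym/orP[]/eqP->;
    rewrite ?eqxx ?aA ?(negPf bA) ?orbb //.
    by move=> /eqP ba; move: bA; rewrite ba aA.
  by move=> _ /eqP ab; move: bA; rewrite -ab aA.
case: (boolP (x \in A)) => xA; case: (boolP (y \in A)) => yA //= _.
  by exists x y; rewrite ?inE.
by exists y x; rewrite ?inE // setUC.
Qed.

Lemma cut_pairs A : cut A \subset pairs T.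
Proof.
apply/subsetP=> _ /imset2P[x y xA yA ->]; rewrite mem_pairs2.
by apply: contraTneq xA => ->; rewrite inE in yA.
Qed.

Lemma symdiff_pairs E F :
  E \subset pairs T -> F \subset pairs T -> symdiff E F \subset pairs T.
Proof.
move=> /subsetP sE /subsetP sF; apply/subsetP=> p; rewrite inE.
by case: (boolP (p \in E)) => [/sE //|_ /= /sF].
Qed.

Lemma symdiffK E F : symdiff (symdiff E F) F = E.
Proof. by apply/setP=> p; rewrite !inE -addbA addbb addbF. Qed.

Lemma card_symdiff E F : #|symdiff E F| + 2 * #|E :&: F| = #|E| + #|F|.
Proof.
rewrite -(cardsID F E) -(cardsID E F) (setIC F E).
have -> : symdiff E F = (E :\: F) :|: (F :\: E).
  by apply/setP=> p; rewrite !inE; case: (p \in E); case: (p \in F).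
have := cardsUI (E :\: F) (F :\: E).
have -> : (E :\: F) :&: (F :\: E) = set0.
  by apply/setP=> p; rewrite !inE; case: (p \in E); case: (p \in F).
rewrite cards0; lia.
Qed.

Lemma card_set3 x y z : x != y -> x != z -> y != z -> #|[set x; y; z]| = 3.
Proof.
move=> xy xz yz; rewrite setUC cardsU1 cards2 !inE xy.
by rewrite ![z == _]eq_sym (negPf xz) (negPf yz).
Qed.

Lemma triple_ext t u v : #|t| = 3 -> u != v -> [set u; v] \subset t ->
  exists2 w, w \notin [set u; v] & t = [set u; v; w].
Proof.
move=> t3 uv st.
have : #|t :\: [set u; v]| == 1 by rewrite cardsD (setIidPr st) t3 cards2 uv.
case/cards1P=> w e.
have : w \in t :\: [set u; v] by rewrite e set11.
rewrite in_setD => /andP[wn wt]; exists w => //.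
by rewrite -e -[LHS](setID _ [set u; v]) (setIidPr st).
Qed.

Lemma tripleP t : #|t| = 3 ->
  exists x y z, [/\ x != y, x != z, y != z & t = [set x; y; z]].
Proof.
move=> t3; have /card_gt1P[x [y [xt yt xy]]] : 1 < #|t| by rewrite t3.
have [|w] := triple_ext t3 xy; first by rewrite subUset !sub1set xt.
rewrite !inE negb_or => /andP[wx wy] ->.
by exists x, y, w; split=> //; rewrite eq_sym.
Qed.

Lemma frustE E x y z : E \subset pairs T -> x != y -> x != z -> y != z ->
  frust E [set x; y; z] =
    ([set x; y] \in E) (+) ([set x; z] \in E) (+) ([set y; z] \in E).
Proof.
move=> /subsetP sE xy xz yz; rewrite /frust card_set3 //=.
have e1 : [set x; y] != [set x; z] by rewrite set2_eqr.
have e2 : [set x; y] != [set y; z] by rewrite [[set x; y]]setUC set2_eqr.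
have e3 : [set x; z] != [set y; z].
  by rewrite [[set x; z]]setUC [[set y; z]]setUC set2_eqr.
set P3 := [set x; y] |: [set [set x; z]; [set y; z]].
have -> : [set p in E | p \subset [set x; y; z]] = [set p in P3 | p \in E].
  apply/setP=> p; rewrite !inE andbC.
  case: (boolP (p \in E)) => pE; rewrite ?andbF ?andbT //.
  have /pairsP[a [b [ab ->]]] := sE _ pE.
  apply/idP/idP.
    rewrite subUset !sub1set !inE.
    case/andP=> /orP[/orP[]|] /eqP ea /orP[/orP[]|] /eqP eb;
      move: ab; rewrite ea eb ?eqxx ?orbT // => _;
      by rewrite setUC eqxx ?orbT.
  case/orP=> [|/orP[]] /eqP ->; rewrite subUset !sub1set !inE !eqxx ?orbT //.
have -> : #|[set p in P3 | p \in E]| = \sum_(p in P3) (p \in E).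
  rewrite -sum1_card big_mkcond [RHS]big_mkcond; apply: eq_bigr => p _.
  by rewrite inE; case: (p \in P3); case: (p \in E).
rewrite big_setU1 ?inE ?negb_or ?e1 //= big_setU1 ?inE //= big_set1.
by rewrite !oddD !oddb addbA.
Qed.

(** * Switching and deletion of an edge *)

(** A triple meets a cut in 0 or 2 pairs. *)
Lemma frust_switch E A t : E \subset pairs T ->
  frust (symdiff E (cut A)) t = frust E t.
Proof.
move=> sE; have [t3|t3] := eqVneq #|t| 3; last by rewrite /frust (negPf t3).
have [x [y [z [xy xz yz ->]]]] := tripleP t3.
rewrite !frustE ?symdiff_pairs ?cut_pairs // ![_ \in symdiff _ _]inE !mem_cut.
by do !case: (_ \in _).
Qed.

Lemma nfrust_switch E A : E \subset pairs T ->
  nfrust (symdiff E (cut A)) = nfrust E.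
Proof.
move=> sE; congr #|pred_of_set _|; apply/setP=> t.
by rewrite !inE frust_switch.
Qed.

(** Deleting uv toggles the triples uvw only; before the deletion uvw is
    frustrated exactly when w is adjacent to both or to none of u and v. *)
Lemma nfrust_del_edge E u v :
    E \subset pairs T -> u != v -> [set u; v] \in E ->
  nfrust E + 2 * #|splitters E u v| + 2 = nfrust (E :\ [set u; v]) + #|T|.
Proof.
move=> sE uv uvE; pose E' := E :\ [set u; v].
have sE' : E' \subset pairs T by rewrite (subset_trans (subsetDl _ _)).
(* U collects the triples that contain u and v. *)
pose U := [set t : {set T} | [set u; v] \subset t].
pose phi w := [set u; v; w].
have neq w : w \notin [set u; v] -> (u != w) * (v != w).
  by rewrite !inE negb_or ![w == _]eq_sym => /andP[-> ->].
have frE w :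
    w \notin [set u; v] -> frust E (phi w) = (w \notin splitters E u v).
  move=> wn; have nw := neq _ wn; rewrite frustE ?nw // uvE inE wn /=.
  by do 2!case: (_ \in E).
have frE' w :
    w \notin [set u; v] -> frust E' (phi w) = (w \in splitters E u v).
  move=> wn; have nw := neq _ wn; rewrite frustE ?nw //.
  rewrite [_ \in splitters _ _ _]inE wn /= !in_setD1 eqxx /=.
  have -> /= : [set u; w] != [set u; v].
    by rewrite set2_eqr eq_sym nw.
  have -> //= : [set v; w] != [set u; v].
  by rewrite [X in _ != X]setUC set2_eqr eq_sym nw.
have inj : {in ~: [set u; v] &, injective phi}.
  move=> w w'; rewrite !in_setC => wn wn' /setP /(_ w).
  rewrite in_setU set11 orbT => /esym; rewrite in_setU (negPf wn) /=.
  by rewrite inE => /eqP.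
have img F B : F \subset pairs T -> B \subset ~: [set u; v] ->
    (forall w, w \notin [set u; v] -> frust F (phi w) = (w \in B)) ->
  #|[set t | frust F t] :&: U| = #|B|.
  move=> sF sB h; rewrite -(card_in_imset (D := B) (f := phi)); last first.
    by move=> w w' /(subsetP sB) ? /(subsetP sB) ?; apply: inj.
  apply: eq_card => t; rewrite !inE; apply/andP/imsetP => [[ft st]|[w wB ->]].
    have /andP[/eqP t3 _] := ft.
    have [w wn e] := triple_ext t3 uv st; exists w => //.
    by rewrite -h // /phi -e.
  rewrite h ?wB ?subsetUl //.
  by rewrite -in_setC (subsetP sB).
have eqD : [set t | frust E t] :\: U = [set t | frust E' t] :\: U.
  apply/setP=> t; rewrite !inE; case: (boolP (_ \subset t)) => //= nst.
  rewrite /frust; congr (_ && odd #|pred_of_set _|).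
  apply/setP=> p; rewrite !inE.
  by case: eqVneq => // ->; rewrite (negPf nst) andbF.
rewrite /nfrust -(cardsID U [set t | frust E t]).
rewrite -(cardsID U [set t | frust (E :\ _) t]).
have sd : splitters E u v \subset ~: [set u; v].
  by apply/subsetP=> w; rewrite in_setC [_ \in splitters _ _ _]inE => /andP[].
rewrite (img E (~: [set u; v] :\: splitters E u v)) ?subsetDl //; last first.
  by move=> w wn; rewrite frE // in_setD in_setC wn andbT.
rewrite (img E' (splitters E u v)) // eqD.
have := cardsID (splitters E u v) (~: [set u; v]); rewrite (setIidPr sd).
have := cardsC [set u; v]; rewrite cards2 uv /E' /=.
move: #|_ :\: splitters _ _ _| #|_ :\: U| #|splitters _ _ _| => a b c; lia.
Qed.

(** * The star bound *)

Lemma splitters_neq E u v w : w \in splitters E u v ->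
  ((w == u) = false) * ((w == v) = false).
Proof. by rewrite !inE negb_or => /andP[/andP[/negPf-> /negPf->]]. Qed.

(** For w in splitters E u v, the edge of E joining w to u or to v. *)
Definition dedge E u v w := if [set u; w] \in E then [set u; w] else [set v; w].

Lemma dedge_inj E u v : {in splitters E u v &, injective (dedge E u v)}.
Proof.
move=> w w' /splitters_neq wn _ e.
have : w \in dedge E u v w' by rewrite -e /dedge; case: ifP; rewrite set22.
by rewrite /dedge; case: ifP => _; rewrite !inE ?wn /= => /eqP.
Qed.

Lemma dedge_sub E u v :
  [set dedge E u v w | w in splitters E u v] \subset E :\ [set u; v].
Proof.
apply/subsetP=> _ /imsetP[w wd ->]; have wn := splitters_neq wd.
move: wd; rewrite /dedge inE => /andP[_]; case: ifP => /= uw.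
  by rewrite in_setD1 uw set2_eqr wn.
by move=> vw; rewrite in_setD1 vw [X in _ != X]setUC set2_eqr wn.
Qed.

Lemma card_splitters_lt E u v : [set u; v] \in E -> #|splitters E u v| < #|E|.
Proof.
move=> uvE; rewrite -(card_in_imset (@dedge_inj E u v)).
rewrite (cardsD1 [set u; v] E) uvE.
by rewrite ltnS subset_leq_card // dedge_sub.
Qed.

(** When the bound of card_splitters_lt is reached, every edge of E meets {u, v}
    and uv lies in no triangle. *)
Lemma splitters_tight E u v :
    [set u; v] \in E -> #|splitters E u v|.+1 = #|E| ->
  (forall p, p \in E -> (u \in p) || (v \in p)) /\
  (forall w, w \notin [set u; v] -> [set u; w] \in E -> [set v; w] \notin E).
Proof.
move=> uvE tight.
have eqE : [set dedge E u v w | w in splitters E u v] = E :\ [set u; v].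
  apply/eqP; rewrite eqEcard dedge_sub /= (card_in_imset (@dedge_inj E u v)).
  by rewrite -ltnS tight (cardsD1 [set u; v] E) uvE.
split=> [p pE|w wn uw].
  have [->|pn] := eqVneq p [set u; v]; first by rewrite set21.
  have : p \in E :\ [set u; v] by rewrite in_setD1 pn.
  rewrite -eqE => /imsetP[w _ ->].
  by rewrite /dedge; case: ifP; rewrite set21 ?orbT.
apply/negP=> vw.
have : [set u; w] \in E :\ [set u; v].
  rewrite in_setD1 uw set2_eqr andbT.
  by move: wn; rewrite !inE negb_or => /andP[].
rewrite -eqE => /imsetP[w' w'd /setP /(_ w)]; rewrite set22 => /esym.
suff -> : w \in dedge E u v w' = (w == w').
  by move=> /eqP e; move: w'd; rewrite -e inE uw vw /= andbF.
move: wn; rewrite !inE negb_or => /andP[wu wv].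
by rewrite /dedge; case: ifP; rewrite !inE ?(negPf wu) ?(negPf wv).
Qed.

Lemma tight_is_star E : E \subset pairs T ->
    (forall u v, u != v -> [set u; v] \in E -> #|splitters E u v|.+1 = #|E|) ->
  is_star E.
Proof.
move=> /subsetP sE tight; have [->|[p pE]] := set_0Vmem E; first by left.
right; have /pairsP[u [v [uv ep]]] := sE _ pE; subst p.
have [meet notri] := splitters_tight pE (tight _ _ uv pE).
case: (boolP [forall q in E, u \in q]) => [/forall_inP|]; first by exists u.
rewrite negb_forall => /existsP[q]; rewrite negb_imply => /andP[qE uq].
have vq : v \in q by have := meet _ qE; rewrite (negPf uq).
(* The edge q avoids u, so q = vw.  As q is tight too, an edge avoiding v
   would have to be uw, and uvw would be a triangle. *)
have [w [vw eq]] : exists w, v != w /\ q = [set v; w].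
  have /pairsP[x [y [xy eq]]] := sE _ qE; move: vq; rewrite eq !inE.
  by case/orP=> /eqP ->; [exists y|exists x; rewrite eq_sym setUC].
subst q; have uw : u != w by apply: contraNneq uq => ->; rewrite set22.
have [meet' _] := splitters_tight qE (tight _ _ vw qE).
exists v => q q_E; apply: contraT => vnq.
have uinq : u \in q by have := meet _ q_E; rewrite (negPf vnq) orbF.
have winq : w \in q by have := meet' _ q_E; rewrite (negPf vnq).
have eq : q = [set u; w].
  apply/esym/eqP; rewrite eqEcard subUset !sub1set uinq winq cards2 uw.
  by have := sE _ q_E; rewrite inE => /eqP ->.
have := notri w; rewrite -eq q_E qE; apply=> //.
by rewrite !inE negb_or ![w == _]eq_sym uw vw.
Qed.

Lemma del_pairs E p : E \subset pairs T -> E :\ p \subset pairs T.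
Proof. exact: subset_trans (subsetDl _ _). Qed.

Lemma nfrust0 : nfrust (set0 : {set {set T}}) = 0.
Proof.
rewrite /nfrust; apply: eq_card0 => t; rewrite !inE /frust.
rewrite (_ : [set p in _ | _] = set0) ?cards0 ?andbF //.
by apply/setP=> p; rewrite !inE.
Qed.

(** f >= a_t for every graph with t edges, without subtraction. *)
Lemma nfrust_ge E : E \subset pairs T ->
  #|E| * #|T| <= nfrust E + #|E| * #|E|.+1.
Proof.
move: {2}#|E| (erefl #|E|) => k; elim: k E => [|k IH] E ek sE.
  by rewrite ek.
have /card_gt0P[p pE] : 0 < #|E| by rewrite ek.
have /pairsP[u [v [uv ep]]] := subsetP sE _ pE; subst p.
have cE : #|E :\ [set u; v]| = k.
  by move: ek; rewrite (cardsD1 [set u; v]) pE => -[].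
have := IH _ cE (del_pairs _ sE); have := nfrust_del_edge sE uv pE.
have := card_splitters_lt pE; rewrite cE ek; nia.
Qed.

(** The star bound cannot be missed by exactly one: a graph below a_t + 2 is
    a star. *)
Lemma nfrust_small_star E : E \subset pairs T ->
  nfrust E + #|E| * #|E|.+1 < #|E| * #|T| + 2 -> is_star E.
Proof.
move=> sE small.
case: (boolP [forall u, forall v, (u != v) && ([set u; v] \in E) ==>
                (#|splitters E u v|.+1 == #|E|)]) => [/'forall_forallP h|].
  apply: tight_is_star => // u v uv uvE.
  by have /implyP := h u v; rewrite uv uvE => /(_ isT)/eqP.
rewrite negb_forall => /existsP[u]; rewrite negb_forall => /existsP[v].
rewrite negb_imply => /andP[/andP[uv uvE] ne]; exfalso.
have := nfrust_ge (del_pairs [set u; v] sE); have := nfrust_del_edge sE uv uvE.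
have := card_splitters_lt uvE; move: ne small.
rewrite (cardsD1 [set u; v] E) uvE /= add1n !mulSn !mulnS.
move: #|E :\ _| #|splitters _ _ _| => k d /eqP ne + lt_d.
have : d < k by lia.
move: #|T| (nfrust E) (nfrust (_ :\ _)) => n f f1; lia.
Qed.

Lemma nfrust_star E : E \subset pairs T -> is_star E ->
  nfrust E + #|E| * #|E|.+1 = #|E| * #|T|.
Proof.
move=> sE [->|[v]]; first by rewrite nfrust0 cards0.
move: {2}#|E| (erefl #|E|) sE => k; elim: k E => [|k IH] E ek sE star.
  by rewrite ek; move/cards0_eq: ek => ->; rewrite nfrust0.
have /card_gt0P[p pE] : 0 < #|E| by rewrite ek.
have other q : q \in E -> exists2 w, v != w & q = [set v; w].
  move=> qE; have := star _ qE; have /pairsP[x [y [xy ->]]] := subsetP sE _ qE.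
  rewrite !inE => /orP[] /eqP ->; first by exists y.
  by exists x; rewrite 1?eq_sym 1?setUC.
have [u vu ep] := other _ pE; subst p.
have cE : #|E :\ [set v; u]| = k.
  by move: ek; rewrite (cardsD1 [set v; u]) pE => -[].
have le_k : k <= #|splitters E v u|.
  rewrite -cE; apply: leq_trans (leq_imset_card (fun w => [set v; w]) _).
  apply/subset_leq_card/subsetP=> q; rewrite in_setD1 => /andP[qn qE].
  have [w vw eq] := other _ qE; subst q; apply: imset_f.
  move: qn; rewrite set2_eqr => wu; rewrite !inE negb_or wu eq_sym vw qE /=.
  by apply/negP=> /star; rewrite !inE (negPf vu) (negPf vw).
have := IH _ cE (del_pairs _ sE); have := nfrust_del_edge sE vu pE.
have := card_splitters_lt pE; rewrite cE ek => d1 d2 d3.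
have/d3 : forall p, p \in E :\ [set v; u] -> v \in p.
  by move=> q /setD1P[_ /star].
nia.
Qed.

(** * Degrees and graphs that are minimal under switching *)

(** The neighbourhood of v. *)
Definition nb E v : {set T} := [set w | [set v; w] \in E].

Lemma nb_neq E v w : E \subset pairs T -> w \in nb E v -> v != w.
Proof. by move=> /subsetP sE; rewrite inE => /sE; rewrite mem_pairs2. Qed.

Lemma card_cut A : #|cut A| = #|A| * #|~: A|.
Proof.
rewrite -cardsX /cut curry_imset2X card_in_imset //.
move=> [x y] [x' y']; rewrite !in_setX /= !in_setC.
move=> /andP[xA yA] /andP[xA' yA'] /setP e.
have := e x; rewrite !inE eqxx /= => /esym/orP[]/eqP ex; last first.
  by move: yA'; rewrite -ex xA.
have := e y; rewrite !inE eqxx orbT /= => /esym/orP[]/eqP ey.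
  by move: yA; rewrite ey xA'.
by rewrite ex ey.
Qed.

(** Switching at the neighbourhood of v isolates v, so that v together with
    a pair of vertices is frustrated when this pair is an edge of the
    switched graph. *)
Lemma card_frust_at E v : E \subset pairs T ->
  #|[set t | frust E t & v \in t]| = #|symdiff E (cut (nb E v))|.
Proof.
move=> sE; set F := symdiff E _.
have sF : F \subset pairs T by rewrite symdiff_pairs ?cut_pairs.
have iso w : [set v; w] \notin F.
  rewrite inE mem_cut !inE setUid.
  have -> : [set v] \in E = false.
    by apply: contraFF (erefl false) => /(subsetP sE); rewrite inE cards1.
  by rewrite /= addbb.
have isoF p : p \in F -> v \notin p.
  move=> pF; have /pairsP[x [y [_ e]]] := subsetP sF _ pF; rewrite e in pF *.
  rewrite !inE; apply/norP; split; apply/eqP=> vx; move: pF.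
    by rewrite -vx (negPf (iso _)).
  by rewrite setUC -vx (negPf (iso _)).
rewrite -(card_in_imset (D := F) (f := fun p => v |: p)); last first.
  by move=> p q /isoF vp /isoF vq e; rewrite -(setU1K vp) e setU1K.
have frF x y : v != x -> v != y -> x != y ->
    frust E [set v; x; y] = ([set x; y] \in F).
  move=> vx vy xy; rewrite -(frust_switch (nb E v)) // -/F frustE //.
  by rewrite (negPf (iso x)) (negPf (iso y)).
apply: eq_card => t; rewrite inE; apply/andP/imsetP => [[ft vt]|[p pF ->]].
  have /andP[/eqP t3 _] := ft.
  have [x xt vx] : exists2 x, x \in t & v != x.
    have : 0 < #|t :\ v| by move: t3; rewrite (cardsD1 v t) vt add1n => -[->].
    by case/card_gt0P=> x; rewrite in_setD1 eq_sym => /andP[vx xt]; exists x.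
  have [|y yn e] := triple_ext t3 vx; first by rewrite subUset !sub1set vt.
  move: yn; rewrite !inE negb_or ![y == _]eq_sym => /andP[vy xy].
  by exists [set x; y]; [rewrite -frF // -e|rewrite e setUA].
have vp := isoF _ pF; have /pairsP[x [y [xy e]]] := subsetP sF _ pF; subst p.
move: vp; rewrite !inE negb_or => /andP[vx vy].
by rewrite setUA frF // eqxx.
Qed.

Lemma sum_frust_at E :
  \sum_v #|[set t | frust E t & v \in t]| = 3 * nfrust E.
Proof.
rewrite (eq_bigr (fun v => \sum_(t | frust E t) (v \in t))); last first.
  move=> v _; rewrite -sum1_card big_mkcond [RHS]big_mkcond.
  by apply: eq_bigr => t _; rewrite inE; case: frust; case: (v \in t).
rewrite exchange_big /= (eq_bigr (fun=> 3)); last first.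
  move=> t /andP[/eqP <- _]; rewrite -sum1_card [RHS]big_mkcond.
  by apply: eq_bigr => v _; case: (v \in t).
rewrite sum_nat_const mulnC /nfrust; congr (_ * _); apply: eq_card => t.
by rewrite !inE.
Qed.

(** E has the fewest edges among the graphs obtained from it by switching. *)
Definition switch_minimal E := forall A, #|E| <= #|symdiff E (cut A)|.

Lemma switch_minimal_nfrust E : E \subset pairs T -> switch_minimal E ->
  #|T| * #|E| <= 3 * nfrust E.
Proof.
move=> sE mE; rewrite -sum_frust_at -sum_nat_const.
by apply: leq_sum => v _; rewrite card_frust_at.
Qed.

(** Otherwise switching at the single vertex v would lose edges. *)
Lemma switch_minimal_deg E v : E \subset pairs T -> switch_minimal E ->
  2 * #|nb E v| < #|T|.
Proof.
move=> sE mE; have := mE [set v]; have := card_symdiff E (cut [set v]).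
rewrite card_cut cards1; have := cardsC [set v]; rewrite cards1.
have : #|nb E v| <= #|E :&: cut [set v]|.
  rewrite -(card_imset (nb E v) (f := fun w => [set v; w])); last first.
    by move=> w w' /eqP; rewrite set2_eqr => /eqP.
  apply/subset_leq_card/subsetP=> _ /imsetP[w wv ->].
  have := nb_neq sE wv; move: wv; rewrite !inE mem_cut !inE => -> /negPf.
  by rewrite eqxx eq_sym => ->.
move: #|nb E v| #|_ :&: _| #|symdiff _ _| #|E| #|~: _| #|T| => a b c d e f; lia.
Qed.

(** Suppose that no edge can be removed, and let d be the maximal degree,
    attained at u.  For a neighbour v of u, let R v be the set of neighbours
    of v that are not neighbours of u; it contains u.  The size of
    splitters E u v is at most (d - 1) + (#|R v| - 1), so that
    2 #|R v| >= n + 3 - 2 d.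
    The edges from v to R v have v as their only endpoint in the
    neighbourhood of u, hence they are distinct for distinct v, and
    2 #|E| >= d (n + 3 - 2 d).  Moreover 4 d >= n + 3, because
    #|R v| <= d.  With 2 d < n this gives 4 #|E| >= 4 (n - 1) >= 3 n. *)
Lemma exists_removable E : E \subset pairs T -> E != set0 -> 4 < #|T| ->
    (forall v, 2 * #|nb E v| < #|T|) -> 4 * #|E| < 3 * #|T| ->
  exists u v,
    [/\ u != v, [set u; v] \in E & 2 * #|splitters E u v| + 2 <= #|T|].
Proof.
move=> sE E0 n4 deg small.
case: (boolP [exists u, exists v, [&& u != v, [set u; v] \in E
    & 2 * #|splitters E u v| + 2 <= #|T|]]).
  by case/existsP=> u /existsP[v /and3P[]]; exists u, v.
move=> none.
have large u v : v \in nb E u -> #|T| <= 2 * #|splitters E u v| + 1.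
  move=> uv; have un := nb_neq sE uv; move: uv; rewrite inE => uv.
  move: none; rewrite negb_exists => /forallP/(_ u).
  rewrite negb_exists => /forallP/(_ v); rewrite un uv /= -ltnNge.
  by rewrite addn2 addn1 ltnS.
have /set0Pn[p pE] := E0.
have /pairsP[x [y [xy e]]] := subsetP sE _ pE; subst p.
pose u := [arg max_(u > x) #|nb E u|].
have umax v : #|nb E v| <= #|nb E u|.
  by rewrite /u; case: arg_maxnP => //= i _; apply.
have nbC a b : (a \in nb E b) = (b \in nb E a) by rewrite !inE setUC.
have dsub v : v \in nb E u ->
    splitters E u v \subset (nb E u :\ v) :|: ((nb E v :\: nb E u) :\ u).
  move=> vu; apply/subsetP=> w; rewrite !inE negb_or => /andP[/andP[-> ->]] /=.
  by case: (_ \in E); case: (_ \in E).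
pose R v := nb E v :\: nb E u.
have uR v : v \in nb E u -> u \in R v.
  move=> vu; rewrite in_setD nbC vu andbT; apply/negP=> /(nb_neq sE).
  by rewrite eqxx.
have Rge v : v \in nb E u -> #|T| + 3 <= 2 * (#|nb E u| + #|R v|).
  move=> vu; have := large _ _ vu; have := subset_leq_card (dsub _ vu).
  have := leq_of_leqif (leq_card_setU (nb E u :\ v) (R v :\ u)).
  rewrite -/(R v).
  have := cardsD1 v (nb E u); have := cardsD1 u (R v); rewrite vu uR // !add1n.
  move: #|_ :|: _| #|splitters _ _ _| #|R v| #|R v :\ u| #|nb E u|.
  move=> a b c d f; move: #|_ :\ v| #|T|.
  lia.
have sumR : \sum_(v in nb E u) #|R v| <= #|E|.
  apply: (@leq_trans (\sum_(v in nb E u)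
    \sum_(p in E) (p :&: nb E u == [set v]))).
    apply: leq_sum => v vu.
    rewrite -(card_imset (R v) (f := fun w => [set v; w])); last first.
      by move=> w w' /eqP; rewrite set2_eqr => /eqP.
    rewrite -sum1_card big_mkcond [leqRHS]big_mkcond; apply: leq_sum => p _.
    case: imsetP => // -[w]; rewrite !inE => /andP[wu wv] ->; rewrite wv.
    suff -> : [set v; w] :&: nb E u == [set v] by [].
    apply/eqP/setP=> z; rewrite !inE; case: eqVneq => [->|_] /=.
      by move: vu; rewrite inE.
    by case: eqVneq => [->|//]; rewrite (negPf wu).
  (* Each edge is counted at most once. *)
  rewrite exchange_big /= -sum1_card; apply: leq_sum => p _.
  case: (boolP [exists v in nb E u, p :&: nb E u == [set v]]).
    case/exists_inP=> v vu /eqP ->; rewrite (bigD1 v) //= eqxx big1 // => z.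
    case/andP=> _ zv.
    by rewrite eqEsubset !sub1set !inE eq_sym (negPf zv).
  rewrite negb_exists_in => /forall_inP h; rewrite big1 // => v vu.
  by rewrite (negPf (h v vu)).
have deg0 : 0 < #|nb E u|.
  by apply: leq_trans (umax x); apply/card_gt0P; exists y; rewrite inE.
have [v vu] := card_gt0P deg0.
have : 2 * #|E| >= #|nb E u| * (#|T| + 3 - 2 * #|nb E u|).
  apply: leq_trans (leq_mul (leqnn 2) sumR).
  rewrite big_distrr /= -sum_nat_const; apply: leq_sum => w /Rge.
  move: #|R w| #|nb E u| #|T|; lia.
have le2 : #|R v| <= #|nb E u|.
  exact: leq_trans (subset_leq_card (subsetDl _ _)) (umax v).
have := deg u; have := Rge v vu; move: n4 small le2.
move: #|R v| #|nb E u| #|T| #|E| => r d n t; nia.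
Qed.

Lemma nb_sub E F v : E \subset F -> nb E v \subset nb F v.
Proof. by move=> /subsetP sEF; apply/subsetP=> w; rewrite !inE => /sEF. Qed.

Lemma star_le_deg E v : E \subset pairs T -> (forall p, p \in E -> v \in p) ->
  #|E| <= #|nb E v|.
Proof.
move=> /subsetP sE star.
apply: leq_trans (leq_imset_card (fun w => [set v; w]) _).
apply/subset_leq_card/subsetP=> q qE; have := star _ qE.
have /pairsP[x [y [_ e]]] := sE _ qE; rewrite e in qE *.
rewrite !inE => /orP[] /eqP ->; first by apply: imset_f; rewrite inE.
by rewrite setUC; apply: imset_f; rewrite inE setUC.
Qed.

(** The conclusion reads 4 f > (n - 1)^2. *)
Lemma nfrust_gt_middle E : E \subset pairs T ->
    (forall v, 2 * #|nb E v| < #|T|) ->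
    #|T| <= 2 * #|E| -> 4 * #|E| < 3 * #|T| ->
  #|T| * #|T| + 1 < 4 * nfrust E + 2 * #|T|.
Proof.
move: {2}#|E| (erefl #|E|) => k; elim: k E => [|k IH] E ek sE deg lo hi.
  by move: lo hi; rewrite ek; lia.
(* In the base case #|E| = k.+1 is n / 2 rounded up, and a star of that size
   would violate the degree condition. *)
have [base|step] := ltnP (2 * k) #|T|.
  have [big|/(nfrust_small_star sE)] :=
      leqP (#|E| * #|T| + 2) (nfrust E + #|E| * #|E|.+1).
    move: big lo base; rewrite ek; move: (nfrust E) #|T| => f n; nia.
  case=> [e|[v /(star_le_deg sE) le_deg]]; first by rewrite e cards0 in ek.
  have := deg v; move: le_deg lo; lia.
have E0 : E != set0 by rewrite -card_gt0 ek.
have n4 : 4 < #|T| by move: hi step; rewrite ek; lia.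
have [u [v [uv uvE small]]] := exists_removable sE E0 n4 deg hi.
have cE : #|E :\ [set u; v]| = k.
  by move: ek; rewrite (cardsD1 [set u; v]) uvE => -[].
have := IH _ cE (del_pairs _ sE); have := nfrust_del_edge sE uv uvE.
rewrite cE => e /(_ _ step) h.
have deg' w : 2 * #|nb (E :\ [set u; v]) w| < #|T|.
  apply: leq_ltn_trans (deg w).
  by rewrite leq_mul // subset_leq_card // nb_sub // subsetDl.
have {h} := h deg'; move: e small hi; rewrite ek.
move: (nfrust E) (nfrust (_ :\ _)) #|splitters _ _ _| #|T| => f f' d n; lia.
Qed.

(** The same conclusion without an upper bound on the number of edges: when
    4 t >= 3 n it follows from n t <= 3 f. *)
Lemma switch_minimal_large E : E \subset pairs T -> switch_minimal E ->
    0 < #|T| -> #|T| <= 2 * #|E| ->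
  #|T| * #|T| + 1 < 4 * nfrust E + 2 * #|T|.
Proof.
move=> sE mE n0 lo.
have [hi|hi] := ltnP (4 * #|E|) (3 * #|T|).
  by apply: nfrust_gt_middle => // v; apply: switch_minimal_deg.
have := switch_minimal_nfrust sE mE; move: n0 lo hi.
move: #|T| #|E| (nfrust E) => n t f; nia.
Qed.

(** Two successive switchings amount to a single one. *)
Lemma symdiff_cut E A B : symdiff (symdiff E (cut A)) (cut B) =
  symdiff E (cut [set x | (x \in A) (+) (x \in B)]).
Proof.
apply/setP=> p; rewrite !inE -addbA; congr (_ (+) _).
case: (boolP (p \in pairs T)) => [/pairsP[x [y [_ ->]]]|np].
  by rewrite !mem_cut !inE; do !case: (_ \in _).
have nc C : p \notin cut C by apply: contraNN np => /(subsetP (cut_pairs C)).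
by rewrite !(negPf (nc _)).
Qed.

Lemma exists_switch_minimal E : exists A, switch_minimal (symdiff E (cut A)).
Proof.
exists [arg min_(A < set0) #|symdiff E (cut A)|] => B.
by case: arg_minnP => //= A _ h; rewrite symdiff_cut; apply: h.
Qed.

End EdgeSets.

(** * The distance g(e) to the sizes of complete bipartite graphs *)

Lemma g_dist_le (n : nat) (e : int) (x : nat) : x.*2 <= n ->
  g_dist n e <= `|e - c_bip n x|%N.
Proof.
move=> xn; have lt_x : x < n.+1 by lia.
rewrite /g_dist -minEnat -leEnat.
exact: (bigmin_le_cond _ (j := Ordinal lt_x)).
Qed.

Lemma g_dist_attained (n : nat) (e : int) :
  exists2 x, x.*2 <= n & g_dist n e = `|e - c_bip n x|%N.
Proof.
pose attained g := exists2 x, x.*2 <= n & g = `|e - c_bip n x|%N.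
rewrite /g_dist; apply: (big_ind attained).
- by exists 0.
- by move=> a b ha hb; rewrite /minn; case: ifP.
- by move=> i le_i; exists (val i).
Qed.

Lemma c_bipE n x : x <= n -> c_bip n x = Posz (x * (n - x)).
Proof. by move=> xn; rewrite /c_bip subzn. Qed.

(** Consecutive sizes c_x and c_(x + 1) differ by n - 2 x - 1, so an integer
    between them is at distance less than n / 2 from one of them; above the
    largest size floor (n^2 / 4) the hypothesis gives the bound. *)
Lemma g_dist_lt_half (n e : nat) :
  (Posz e <= (Posz n ^+ 2 %/ 4)%Z + ((Posz n - 1) %/ 2)%Z - 1)%R ->
  2 * g_dist n (Posz e) < n.
Proof.
move=> range.
pose P x := (x.*2 <= n) && (x * (n - x) <= e).
have P0 : exists x, P x by exists 0; rewrite /P mul0n.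
have Pn x : P x -> x <= n by case/andP; lia.
case: (ex_maxnP P0 Pn) => x /andP[xn cx] xmax.
have := g_dist_le (Posz e) xn; rewrite c_bipE; last by lia.
(* x is the largest admissible index with c_x <= e. *)
have [yn|yn] := leqP x.+1.*2 n.
  have cy : e < x.+1 * (n - x.+1).
    rewrite ltnNge; apply/negP=> cy; have := xmax x.+1.
    by rewrite /P yn cy ltnn => /(_ isT).
  have := g_dist_le (Posz e) yn; rewrite c_bipE; last by lia.
  move: (g_dist _ _) => g.
  have [k en] : exists k, n = x.+1 + k by exists (n - x.+1); lia.
  have [ek ek'] : n - x = k.+1 /\ n - x.+1 = k by lia.
  move: cx cy; rewrite ek ek' mulSn mulnS.
  move: (x * k) => xk; lia.
move: (g_dist _ _) => g g_le; move: range cx g_le.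
have [-> | ->] : n = x.*2 \/ n = x.*2.+1 by lia.
  have -> : (Posz x.*2 ^+ 2 %/ 4)%Z = Posz (x * x) by lia.
  have -> : ((Posz x.*2 - 1) %/ 2)%Z = (Posz x - 1)%R by lia.
  have -> : x.*2 - x = x by lia.
  lia.
have -> : (Posz x.*2.+1 ^+ 2 %/ 4)%Z = Posz (x * x.+1) by lia.
have -> : ((Posz x.*2.+1 - 1) %/ 2)%Z = Posz x by lia.
have -> : x.*2.+1 - x = x.+1 by lia.
lia.
Qed.

Section Extremal.
Variable T : finType.
Implicit Types (E F S : {set {set T}}) (A B t : {set T}) (u v w x y z : T).

(** A may have more than n / 2 elements; then its complement gives the
    admissible index. *)
Lemma g_dist_cut A (e : nat) :
  g_dist #|T| (Posz e) <= `|Posz e - Posz #|cut A| |%N.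
Proof.
have := cardsC A; rewrite card_cut => cA.
have [le_A|lt_A] := leqP #|A|.*2 #|T|.
  have := g_dist_le (Posz e) le_A; rewrite c_bipE; last by lia.
  by have -> : #|T| - #|A| = #|~: A| by lia.
have le_C : #|~: A|.*2 <= #|T| by lia.
have := g_dist_le (Posz e) le_C; rewrite c_bipE; last by lia.
have -> : #|T| - #|~: A| = #|A| by lia.
by rewrite mulnC.
Qed.

(** * Comparison of f with a_g *)

Lemma a_star_nfrust S (k : nat) : #|S| = k ->
  nfrust S + #|S| * #|S|.+1 = #|S| * #|T| -> Posz (nfrust S) = a_star #|T| k.
Proof. by rewrite /a_star => ->; move: (nfrust S) #|T| => f n; nia. Qed.

(** a is increasing on the integers below n / 2. *)
Lemma a_star_le (n g t f : nat) : g <= t -> 2 * t < n ->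
  t * n <= f + t * t.+1 -> (a_star n g <= Posz f)%R.
Proof.
move=> gt tn ft; rewrite /a_star.
have [d ed] : exists d, t = g + d by exists (t - g); lia.
have [k ek] : exists k, n = 2 * t + 1 + k by exists (n - (2 * t + 1)); lia.
subst; nia.
Qed.

(** The hypothesis reads (n - 1)^2 < 4 f, and 4 a_g <= (n - 1)^2 for all g. *)
Lemma a_star_lt_large (n g f : nat) : n * n + 1 < 4 * f + 2 * n ->
  (a_star n g < Posz f)%R.
Proof.
rewrite /a_star => h.
have : (0 <= (Posz n - 1 - 2 * Posz g) * (Posz n - 1 - 2 * Posz g))%R.
  by rewrite -expr2 sqr_ge0.
nia.
Qed.

(** The equality case of the lower bound, for t below n / 2. *)
Lemma a_star_inj (n g t f : nat) : g <= t -> 2 * t < n ->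
  t * n <= f + t * t.+1 -> Posz f = a_star n g ->
  t = g /\ f + t * t.+1 = t * n.
Proof.
move=> gt tn ft; rewrite /a_star.
have [d ed] : exists d, t = g + d by exists (t - g); lia.
have [k ek] : exists k, n = 2 * t + 1 + k by exists (n - (2 * t + 1)); lia.
subst; move=> ef.
have d0 : d = 0 by nia.
subst; nia.
Qed.

(** Every graph is the symmetric difference of a switching-minimal graph and
    a complete bipartite graph. *)
Lemma minimal_switch E : E \subset pairs T ->
  exists A F, [/\ F \subset pairs T, switch_minimal F, nfrust F = nfrust E,
    E = symdiff F (cut A) & g_dist #|T| (Posz #|E|) <= #|F|].
Proof.
move=> sE; have [A mF] := exists_switch_minimal E; pose F := symdiff E (cut A).
have eE : E = symdiff F (cut A) by rewrite symdiffK.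
exists A, F; split=> //; first by rewrite symdiff_pairs ?cut_pairs.
  by rewrite nfrust_switch.
apply: leq_trans (g_dist_cut A _) _.
have := card_symdiff F (cut A); rewrite -eE.
have := subset_leq_card (subsetIl F (cut A)); lia.
Qed.

Lemma a_star_le_nfrust E : E \subset pairs T ->
  (a_star #|T| (g_dist #|T| (Posz #|E|)) <= Posz (nfrust E))%R.
Proof.
move=> sE; have [n0|n0] := posnP #|T|.
  suff -> : g_dist #|T| (Posz #|E|) = 0 by rewrite /a_star mul0r.
  have := g_dist_cut set0 #|E|; rewrite card_cut cards0.
  suff -> : E = set0 by rewrite cards0; lia.
  apply/setP=> p; rewrite inE; apply/negP=> /(subsetP sE); rewrite inE.
  by have := max_card (mem p); rewrite n0; case: #|p|.
have [A [F [sF mF <- _ gF]]] := minimal_switch sE.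
have [tn|tn] := ltnP (2 * #|F|) #|T|.
  by apply: a_star_le gF tn (nfrust_ge sF).
exact/ltW/a_star_lt_large/switch_minimal_large.
Qed.

(** In the last conclusion, the star F is deleted from the complete bipartite
    graph in the first case and added to it in the second. *)
Lemma nfrust_eq_a_star E : E \subset pairs T -> 0 < #|T| ->
    Posz (nfrust E) = a_star #|T| (g_dist #|T| (Posz #|E|)) ->
  exists A F, [/\ F \subset pairs T, is_star F,
    #|F| = g_dist #|T| (Posz #|E|), E = symdiff F (cut A)
    & F \subset cut A \/ F :&: cut A = set0].
Proof.
move=> sE n0; have [A [F [sF mF <- eE gF]]] := minimal_switch sE => fF.
have tn : 2 * #|F| < #|T|.
  rewrite ltnNge; apply/negP=> tn.
  have := switch_minimal_large sF mF n0 tn.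
  move/(a_star_lt_large (g_dist #|T| (Posz #|E|))).
  by rewrite fF ltxx.
have [tg ft] := a_star_inj gF tn (nfrust_ge sF) fF.
exists A, F; split=> //; first by apply: nfrust_small_star; rewrite // ft; lia.
(* With i = #|F :&: cut A|, the distance from #|E| to #|cut A| is
   | #|F| - 2 i |, and it is at least #|F|; so i is 0 or #|F|. *)
have gA := g_dist_cut A #|E|; rewrite -tg in gA.
have := card_symdiff F (cut A); rewrite -eE => cE.
have le_I := subset_leq_card (subsetIl F (cut A)).
have [I0|I0] := posnP #|F :&: cut A|; first by right; apply/cards0_eq.
left; apply/setIidPl/eqP; rewrite eqEcard subsetIl /=.
move: gA cE le_I I0; move: #|E| #|F| #|cut A| #|_ :&: _| => e f c i.
lia.
Qed.

Lemma exists_subset_card A k :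
  k <= #|A| -> exists2 B : {set T}, B \subset A & #|B| = k.
Proof.
case/card_geqP=> s [us ss sA]; exists [set x in s].
  by apply/subsetP=> x; rewrite inE => /sA.
by rewrite cardsE (card_uniqP us).
Qed.

(** Such a graph G is obtained from the star by switching at a part of H. *)
Lemma flip_star_nfrustrated k (H G : sgraph T) : complete_bipartite H ->
  delete_star k H G \/ add_star k H G -> Posz (nfrustrated G) = a_star #|T| k.
Proof.
case=> A eH flip; change (nfrustrated G) with (nfrust (edges G)).
suff [S [sS star cS ->]] : exists S, [/\ S \subset pairs T, is_star S, #|S| = k
    & edges G = symdiff S (cut A)].
  by rewrite nfrust_switch //; apply: a_star_nfrust => //; apply: nfrust_star.
case: flip => -[S [sS star cS eG]]; exists S; split=> //.
- exact: subset_trans sS (edges_pairs H).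
- apply/setP=> p; rewrite eG eH !inE -/(cut A).
  by case: (boolP (p \in S)) => //= /(subsetP sS); rewrite eH => ->.
- exact: subset_trans sS (subsetDl _ _).
apply/setP=> p; rewrite eG eH !inE -/(cut A).
case: (boolP (p \in S)) => [/(subsetP sS)|_]; last by rewrite orbF.
by rewrite in_setD eH orbT => /andP[/negPf-> _].
Qed.

(** * Existence of extremal graphs *)

(** The star with centre v and set of leaves A. *)
Definition star v A : {set {set T}} := [set [set v; w] | w in A].

Lemma card_star v A : #|star v A| = #|A|.
Proof. by apply: card_imset => w w' /eqP; rewrite set2_eqr => /eqP. Qed.

Lemma star_is_star v A : is_star (star v A).
Proof. by right; exists v => _ /imsetP[w _ ->]; rewrite set21. Qed.

Lemma exists_extremal e : 2 * g_dist #|T| (Posz e) < #|T| ->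
  exists H G : sgraph T, [/\ #|edges G| = e, complete_bipartite H
    & delete_star (g_dist #|T| (Posz e)) H G \/
      add_star (g_dist #|T| (Posz e)) H G].
Proof.
have [x xn ->] := g_dist_attained #|T| (Posz e).
rewrite c_bipE; last by lia.
have [|A _ cA] := @exists_subset_card setT x; first by rewrite cardsT; lia.
have cAC : #|~: A| = #|T| - x by have := cardsC A; lia.
have cK : #|cut A| = x * (#|T| - x) by rewrite card_cut cA cAC.
rewrite -cK; move ec: #|cut A| cK => c cK small.
pose H := SGraph (cut_pairs A); exists H.
have bH : complete_bipartite H by exists A.
(* If e >= c_x, add a star inside the larger part ~: A; otherwise A is
   nonempty, and delete a star with centre in A. *)
have [le_e|lt_e] := leqP c e.
  have /card_gt0P[v vA] : 0 < #|~: A| by lia.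
  have [|B sB cB] := @exists_subset_card (~: A :\ v) (e - c).
    by have := cardsD1 v (~: A); rewrite vA add1n; lia.
  have sS : star v B \subset pairs T :\: cut A.
    apply/subsetP=> _ /imsetP[w /(subsetP sB) + ->].
    rewrite in_setD1 in_setD mem_cut mem_pairs2 !in_setC in vA *.
    by case/andP=> wv /negPf ->; rewrite (negPf vA) eq_sym.
  have sG : cut A :|: star v B \subset pairs T.
    by rewrite subUset cut_pairs (subset_trans sS) ?subsetDl.
  exists (SGraph sG); split=> //=.
    rewrite cardsU card_star cB (_ : _ :&: _ = set0) ?cards0 ?ec; first by lia.
    apply/setP=> p; rewrite in_setI in_set0; apply/andP=> -[pA /(subsetP sS)].
    by rewrite in_setD pA.
  right; exists (star v B); split=> //; first exact: star_is_star.
  by rewrite card_star cB; lia.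
have /card_gt0P[v vA] : 0 < #|A|.
  by rewrite cA lt0n; apply/eqP=> x0; move: lt_e; rewrite cK x0.
have [|B sB cB] := @exists_subset_card (~: A) (c - e); first by lia.
have sS : star v B \subset cut A.
  apply/subsetP=> _ /imsetP[w /(subsetP sB) + ->].
  by rewrite mem_cut vA inE => /negPf ->.
have sG : cut A :\: star v B \subset pairs T.
  by rewrite (subset_trans (subsetDl _ _)) ?cut_pairs.
exists (SGraph sG); split=> //=.
  by rewrite cardsD (setIidPr sS) card_star cB ec; lia.
left; exists (star v B); split=> //; first exact: star_is_star.
by rewrite card_star cB; lia.
Qed.

End Extremal.

Local Open Scope ring_scope.

Theorem theorem3 (T : finType) (n e : nat) (hn : #|T| = n) :
  (forall G : sgraph T, #|edges G| = e ->
     a_star n (g_dist n e%:Z) <= (nfrustrated G)%:Z)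
  /\
  (e%:Z <= (n%:Z ^+ 2 %/ 4)%Z + ((n%:Z - 1) %/ 2)%Z - 1 ->
     (exists G : sgraph T,
        #|edges G| = e /\ (nfrustrated G)%:Z = a_star n (g_dist n e%:Z))
     /\
     (forall G : sgraph T, #|edges G| = e ->
        ((nfrustrated G)%:Z = a_star n (g_dist n e%:Z) <->
         exists H : sgraph T, complete_bipartite H /\
           (delete_star (g_dist n e%:Z) H G \/ add_star (g_dist n e%:Z) H G)))).
Proof.
rewrite -hn; split=> [G <-|/g_dist_lt_half small].
  exact/a_star_le_nfrust/edges_pairs.
split.
  have [H [G [cG bH flip]]] := exists_extremal small.
  by exists G; split=> //; apply: flip_star_nfrustrated bH flip.
move=> G cG; split=> [fG|[H [bH flip]]]; last first.
  exact: flip_star_nfrustrated bH flip.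
have n0 : (0 < #|T|)%N by apply: leq_trans small.
rewrite -cG in fG *.
have [A [F [sF star cF eG cap]]] := nfrust_eq_a_star (edges_pairs G) n0 fG.
exists (SGraph (cut_pairs A)); split; first by exists A.
case: cap => cap; [left|right]; exists F; split=> //=.
  apply/setP=> p; rewrite eG !inE.
  by case: (boolP (p \in F)) => [/(subsetP cap) ->|_]; rewrite ?andbT.
- apply/subsetP=> p pF; rewrite in_setD (subsetP sF) // andbT.
  by apply/negP=> pA; have := in_set0 p; rewrite -cap inE pF pA.
apply/setP=> p; rewrite eG !inE.
case: (boolP (p \in F)) => [pF|_]; last by rewrite orbF.
by have := in_set0 p; rewrite -cap inE pF /= orbT => ->.
Qed.
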